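(* There is no elusive pair with parameters $(4,3,3)$; that is, there do not exist a code $C$ in the Hamming graph $\Gamma=H(4,3)$ with minimum distance $3$ and a subgroup $X\leq\mathrm{Aut}(\Gamma)$ such that $X$ fixes $\Gamma_1(C)$ setwise but does not fix $C$ setwise.
   Context: Hamming graph: for a finite set $Q$ of size $q$, $\Gamma=H(m,q)$ is the graph whose vertices are all $m$-tuples with entries in $Q$, two $m$-tuples being adjacent if and only if they differ in exactly one position. $\mathrm{Aut}(\Gamma)$ is its automorphism group. The distance $d(\alpha,\beta)$ between vertices is the number of entries in which they differ. A code is a subset $C$ of the vertex set of $\Gamma$; its minimum distance is $\delta=\min\{d(\alpha,\beta)\mid \alpha,\beta\in C,\ \alpha\neq\beta\}$. The set of neighbours of $C$, denoted $\Gamma_1(C)$, is the set of all vertices of $\Gamma$ that are not in $C$ but are adjacent to at least one element of $C$. Elusive pair: let $C$ be a code in $\Gamma=H(m,q)$ with minimum distance $\delta$ and let $X\leq\mathrm{Aut}(\Gamma)$ be such that $X$ fixes $\Gamma_1(C)$ setwise but does not fix $C$ setwise. Then $(C,X)$ is called an elusive pair with parameters $(m,q,\delta)$. *)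

(* Defs.v *)
From mathcomp Require Import all_boot all_fingroup.

Set Implicit Arguments.
Unset Strict Implicit.
Unset Printing Implicit Defensive.

Local Open Scope group_scope.

Section GraphAutomorphisms.

Variables (V : finType) (e : rel V).

Definition graph_aut : {set {perm V}} :=
  [set s : {perm V} | [forall a, forall b, e (s a) (s b) == e a b]].

Lemma graph_autP (s : {perm V}) :
  reflect (forall a b, e (s a) (s b) = e a b) (s \in graph_aut).
Proof.
rewrite inE; apply: (iffP forallP) => [h a b | h a].
  by have /forallP/(_ b)/eqP := h a.
by apply/forallP => b; rewrite h.
Qed.

Lemma graph_aut_group_set : group_set graph_aut.
Proof.
apply/group_setP; split=> [|s t /graph_autP hs /graph_autP ht].
  by apply/graph_autP => a b; rewrite !perm1.
by apply/graph_autP => a b; rewrite !permM ht hs.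
Qed.

Canonical graph_aut_group := Group graph_aut_group_set.

End GraphAutomorphisms.

Section HammingGraph.

Variables (m : nat) (Q : finType).

Definition hamming_dist (a b : m.-tuple Q) : nat :=
  #|[set i : 'I_m | tnth a i != tnth b i]|.

Definition hamming_adj : rel (m.-tuple Q) :=
  fun a b => hamming_dist a b == 1%N.

Definition hamming_aut : {group {perm m.-tuple Q}} :=
  graph_aut_group hamming_adj.

(* The minimum is required to be attained, so a code with fewer than two
   elements has no minimum distance. *)
Definition has_min_distance (C : {set m.-tuple Q}) (delta : nat) : Prop :=
  (exists a b, [/\ a \in C, b \in C, a != b & hamming_dist a b = delta]) /\
  (forall a b, a \in C -> b \in C -> a != b -> delta <= hamming_dist a b).

Definition code_neighbours (C : {set m.-tuple Q}) : {set m.-tuple Q} :=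
  [set v | (v \notin C) && [exists c in C, hamming_adj v c]].

End HammingGraph.

(* 'N(S | 'P) is the setwise stabiliser of S for the natural action of the
   permutations of m.-tuple Q. *)
Definition elusive_pair (m q delta : nat) (Q : finType) (C : {set m.-tuple Q})
    (X : {group {perm m.-tuple Q}}) : Prop :=
  [/\ #|Q| = q,
      has_min_distance C delta,
      X \subset hamming_aut m Q,
      X \subset 'N(code_neighbours C | 'P)
    & ~~ (X \subset 'N(C | 'P))].

Arguments elusive_pair m q delta {Q} C X.

(* Main.v *)
Require Import Defs.
From mathcomp Require Import all_boot all_fingroup.
From mathcomp Require Import all_algebra.

(** The indicator function of a code of minimum distance at least 3 is mapped by
    the adjacency operator [A] of H(m,q) to the indicator function of its set of
    neighbours.  The eigenvalues of [A] are the numbers [(q - 1) m - q j], so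
    [A] is injective unless [q] divides [m], and then the code is determined by
    its neighbours.  Hence an elusive pair with [delta >= 3] has [q %| m], which
    fails for [(m, q) = (4, 3)].

    For the injectivity, let [S_i] be summation over the [i]-th coordinate:
    [A = \sum_i S_i - m], the [S_i] commute and [S_i^2 = q S_i].  If [A g = 0]
    and [S_i g = q g] for [i \in T], then for [i \notin T] the function [S_i g]
    has the same properties for [i |: T], so it vanishes by induction;
    therefore [0 = A g = (q #|T| - m) g]. *)

Set Implicit Arguments.
Unset Strict Implicit.
Unset Printing Implicit Defensive.

Import GRing.Theory Num.Theory.

Section HammingOperator.

Variables (m : nat) (Q : finType).
Implicit Types (v w : m.-tuple Q) (i j : 'I_m) (f g : m.-tuple Q -> int).

Local Open Scope ring_scope.

Definition tuple_upd v i (a : Q) : m.-tuple Q :=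
  [tuple if j == i then a else tnth v j | j < m].

Lemma tuple_updK v i a b : tuple_upd (tuple_upd v i a) i b = tuple_upd v i b.
Proof.
by apply: eq_from_tnth => k; rewrite !tnth_mktuple; case: (k == i).
Qed.

Lemma tuple_updC v i j a b : i != j ->
  tuple_upd (tuple_upd v i a) j b = tuple_upd (tuple_upd v j b) i a.
Proof.
move=> ij; apply: eq_from_tnth => k; rewrite !tnth_mktuple.
by case: (k =P i) => // ->; rewrite (negbTE ij).
Qed.

Definition coord_sum i f v : int := \sum_a f (tuple_upd v i a).

Lemma coord_sum_idem i f v :
  coord_sum i (coord_sum i f) v = #|Q|%:R * coord_sum i f v.
Proof.
rewrite {1}/coord_sum (eq_bigr (fun=> coord_sum i f v)) => [|a _].
  by rewrite sumr_const mulr_natl.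
by apply: eq_bigr => b _; rewrite tuple_updK.
Qed.

Lemma coord_sumC i j f v :
  coord_sum i (coord_sum j f) v = coord_sum j (coord_sum i f) v.
Proof.
have [->//|ij] := eqVneq i j; rewrite /coord_sum exchange_big /=.
by apply: eq_bigr => b _; apply: eq_bigr => a _; rewrite tuple_updC.
Qed.

Lemma eq_coord_sum i f g : f =1 g -> coord_sum i f =1 coord_sum i g.
Proof. by move=> fg v; apply: eq_bigr => a _; rewrite fg. Qed.

Lemma coord_sumZ i f c v : coord_sum i (fun w => c * f w) v = c * coord_sum i f v.
Proof. by rewrite /coord_sum mulr_sumr. Qed.

(** The second hypothesis is [A g = 0], as [A] is the sum of the [S_i] minus [m]. The set [T] is
    there for the induction on the number of coordinates outside it; the case of interest is [T]
    empty. *)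
Lemma sum_coord_sum_inj (T : {set 'I_m}) g :
    ~~ (#|Q| %| m)%N ->
    (forall v, \sum_i coord_sum i g v = m%:R * g v) ->
    (forall i, i \in T -> forall v, coord_sum i g v = #|Q|%:R * g v) ->
  forall v, g v = 0.
Proof.
move=> ndiv; have [n] := ubnP #|~: T|.
elim: n T g => // n IHn T g; rewrite ltnS => leTn Ag gT v.
have S0 i : i \notin T -> coord_sum i g v = 0.
  move=> iT; apply: (IHn (i |: T) (coord_sum i g)) => [|w|j].
  - apply: leq_trans leTn; apply: proper_card; rewrite properC.
    by apply: properUr; rewrite sub1set.
  - rewrite (eq_bigr _ (fun j _ => coord_sumC j i g w)) /coord_sum exchange_big.
    by rewrite mulr_sumr; apply: eq_bigr => a _; apply: Ag.
  - rewrite in_setU1 => /predU1P[->|jT] w; first exact: coord_sum_idem.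
    by rewrite coord_sumC (eq_coord_sum _ (gT j jT)) coord_sumZ.
have := Ag v; rewrite (bigID (mem T)) /= [X in _ + X]big1 ?addr0 => [|i /S0 //].
rewrite (eq_bigr _ (fun i iT => gT i iT v)) sumr_const -mulrnAl -mulrnA.
move/eqP; rewrite -subr_eq0 -mulrBl mulf_eq0 => /orP[|/eqP //].
(* The other factor vanishes only if [m = #|Q| * #|T|], against [ndiv]. *)
by rewrite subr_eq0 eqr_nat => /eqP mE; rewrite -mE dvdn_mulr in ndiv.
Qed.

(** With [i] moved into a condition on [w], the sums over [i] and [w] can be exchanged. *)
Lemma coord_sumE i f v :
  coord_sum i f v
    = \sum_(w | [set k | tnth v k != tnth w k] \subset [set i]) f w.
Proof.
rewrite (reindex_onto (tuple_upd v i) (fun w => tnth w i)) => [|w /subsetP vw].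
  apply: eq_bigl => a; rewrite tnth_mktuple !eqxx andbT.
  apply/esym/subsetP => k; rewrite !inE tnth_mktuple.
  by case: (k == i); rewrite ?eqxx.
apply: eq_from_tnth => k; rewrite tnth_mktuple; case: (k =P i) => [-> //|/eqP ki].
by apply/eqP/negPn/negP => kvw; have := vw k; rewrite !inE kvw (negbTE ki) => /(_ isT).
Qed.

(** Count the [i] for which [[set i]] contains the set of positions where [v] and [w] differ: [m] of
    them if [w = v], one at distance 1, none farther away. *)
Lemma sum_coord_sumE f v :
  \sum_i coord_sum i f v = m%:R * f v + \sum_(w | hamming_adj v w) f w.
Proof.
under eq_bigr => i _ do rewrite coord_sumE.
rewrite (exchange_big_dep xpredT) //= (bigD1 v) //=; congr (_ + _).
  have -> : [set k | tnth v k != tnth v k] = set0.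
    by apply/setP => k; rewrite !inE eqxx.
  by under eq_bigl => i do rewrite sub0set; rewrite sumr_const card_ord mulr_natl.
rewrite big_mkcond [RHS]big_mkcond; apply: eq_bigr => w _.
rewrite /hamming_adj /hamming_dist; set D := [set k | _].
have [wv|wv] /= := eqVneq w v.
  by rewrite (_ : D = set0) ?cards0 //; apply/setP => k; rewrite !inE wv eqxx.
have D0 : D != set0.
  apply: contra_neq wv => D0; apply: eq_from_tnth => k.
  by have /setP/(_ k) := D0; rewrite !inE => /negbFE/eqP.
under eq_bigl => i do rewrite subset1 (negbTE D0) orbF.
have [/cards1P[k ->]|D1] := boolP (#|D| == 1%N).
  by under eq_bigl => i do rewrite (inj_eq set1_inj) eq_sym; rewrite big_pred1_eq.
by rewrite big1 // => i /eqP Di; rewrite Di cards1 in D1.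
Qed.

Lemma hamming_adjacency_inj f g :
    ~~ (#|Q| %| m)%N ->
    (forall v, \sum_(w | hamming_adj v w) f w = \sum_(w | hamming_adj v w) g w) ->
  f =1 g.
Proof.
move=> ndiv fg v; apply/eqP; rewrite -subr_eq0; apply/eqP.
apply: (@sum_coord_sum_inj set0 (fun w => f w - g w)) => // [w|i].
  by rewrite sum_coord_sumE sumrB fg subrr addr0.
by rewrite inE.
Qed.

End HammingOperator.

Section Codes.

Variables (m : nat) (Q : finType).
Implicit Types (v w : m.-tuple Q) (C : {set m.-tuple Q}).

Lemma hamming_distxx v : hamming_dist v v = 0.
Proof. by apply: eq_card0 => k; rewrite !inE eqxx. Qed.

Lemma hamming_distC v w : hamming_dist v w = hamming_dist w v.
Proof. by apply: eq_card => k; rewrite !inE eq_sym. Qed.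

Lemma hamming_dist_triangle u v w :
  hamming_dist u w <= hamming_dist u v + hamming_dist v w.
Proof.
rewrite /hamming_dist -cardsUI; apply: leq_trans (leq_addr _ _).
apply/subset_leq_card/subsetP => k; rewrite !inE -negb_and.
by apply: contra => /andP[/eqP-> /eqP->].
Qed.

(** By the triangle inequality, two codewords adjacent to [v] would be at distance at most 2, so at
    most one term is nonzero; if [v] is itself a codeword, none is. *)
Lemma sum_adj_code C delta v :
    has_min_distance C delta -> 2 < delta ->
  (\sum_(w | hamming_adj v w) (w \in C)%:R = (v \in code_neighbours C)%:R :> int)%R.
Proof.
case=> _ minC delta3; rewrite inE.
have [[c cC vc]|noC] := exists_inP; last first.
  rewrite andbF big1 // => w vw; case: (boolP (w \in C)) => // wC.
  by case: noC; exists w.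
case: (boolP (v \in C)) => [vC|_] /=.
  have vNc : v != c.
    by apply: contraTneq vc => ->; rewrite /hamming_adj hamming_distxx.
  by have := leq_trans delta3 (minC v c vC cC vNc); rewrite (eqP vc).
rewrite (bigD1 c) //= cC big1 ?addr0 // => w /andP[vw wNc].
case: (boolP (w \in C)) => // wC.
have := leq_trans delta3 (leq_trans (minC w c wC cC wNc) (hamming_dist_triangle w v c)).
by rewrite hamming_distC (eqP vw) (eqP vc).
Qed.

Theorem elusive_pair_dvdn q delta C (X : {group {perm m.-tuple Q}}) :
  2 < delta -> elusive_pair m q delta C X -> q %| m.
Proof.
move=> delta3 [<- minC /subsetP Xaut /subsetP XN /negP nXC].
apply/negPn/negP => ndiv; apply: nXC; apply/subsetP => x xX.
apply/astabsP => v; apply/eqP.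
(* Compare the indicators of the preimage of [C] under [x] and of [C]. *)
suff /(_ v)/eqP : (fun w => (x w \in C)%:R : int)%R =1 (fun w => (w \in C)%:R)%R.
  by rewrite eqr_nat; do 2!case: (_ \in C).
apply: hamming_adjacency_inj => // {}v.
(* Both sums tell whether [v] is in [code_neighbours C]: [x] preserves this set, and as an
   automorphism it carries the neighbours of [v] to those of [x v]. *)
rewrite (sum_adj_code v minC delta3) -(astabs_act v (XN x xX)) /= apermE.
rewrite -(sum_adj_code _ minC delta3) [RHS](reindex_inj (@perm_inj _ x)) /=.
by apply: eq_bigl => w; have /graph_autP-> := Xaut x xX.
Qed.

End Codes.

Theorem lemma3p13 (Q : finType) (C : {set 4.-tuple Q})
    (X : {group {perm 4.-tuple Q}}) :
  ~ elusive_pair 4 3 3 C X.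
Proof. by move/elusive_pair_dvdn => /(_ isT). Qed.
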